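(* Let $k\ge3$ and $2\le i\le k-1$. Let $\sigma=\sigma_1\sigma_2\cdots\sigma_k\text{-}\sigma_{k+1}$ be the vincular pattern of length $k+1$ with $\sigma_1<\sigma_2<\cdots<\sigma_{i-1}<\sigma_i>\sigma_{i+1}>\cdots>\sigma_k$ and $\sigma_{k+1}=k+1$. Let $\tau=\tau_1\cdots\tau_k\text{-}\tau_{k+1}$ be the pattern obtained from $\sigma$ by interchanging the letters $k$ and $k+1$. Then $\sigma$ and $\tau$ are Wilf-equivalent, and this equivalence respects the first letter statistic: for all $n\ge1$ and $a\in[n]$, the number of $\pi\in\mathcal{S}_n(\sigma)$ with $\pi_1=a$ equals the number of $\pi\in\mathcal{S}_n(\tau)$ with $\pi_1=a$.
   Context: A vincular pattern is a permutation $\rho\in\mathcal{S}_m$ written with dashes between some consecutive entries; $\pi\in\mathcal{S}_n$ contains it if there are indices $i_1<\cdots<i_m$ with $\pi_{i_1}\cdots\pi_{i_m}$ order-isomorphic to $\rho$ (same relative order) and $i_{j+1}=i_j+1$ whenever $\rho_j,\rho_{j+1}$ are not separated by a dash; otherwise $\pi$ avoids it. $\mathcal{S}_n(\rho)$ is the set of $\rho$-avoiding permutations in $\mathcal{S}_n$. Patterns $\rho,\rho'$ are Wilf-equivalent if $|\mathcal{S}_n(\rho)|=|\mathcal{S}_n(\rho')|$ for all $n\ge0$. *)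

(* Defs.v *)
From mathcomp Require Import all_boot all_fingroup.

Set Implicit Arguments.
Unset Strict Implicit.
Unset Printing Implicit Defensive.

(* Positions and letters are counted from 0: position j and letter v of the    *)
(* usual one-line notation are the ordinals of value j - 1 and v - 1.          *)

(* Gap g : 'I_m.-1 lies between positions g and g.+1; dashes is the set of the *)
(* gaps carrying a dash.                                                       *)
Record vincular (m : nat) := Vincular {
  letters : 'S_m;
  dashes : {set 'I_m.-1}
}.

Definition is_occurrence (m n : nat) (rho : vincular m) (pi : 'S_n)
    (f : {ffun 'I_m -> 'I_n}) : bool :=
  [&& [forall p : 'I_m, forall q : 'I_m, (p < q) ==> (f p < f q)],
      [forall p : 'I_m, forall q : 'I_m,
         (pi (f p) < pi (f q)) == (letters rho p < letters rho q)] &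
      [forall g : 'I_m.-1, (g \notin dashes rho) ==>
         [forall p : 'I_m, forall q : 'I_m,
            (p == g :> nat) && (q == g.+1 :> nat) ==>
            (f q == (f p).+1 :> nat)]]].

Definition contains (m n : nat) (rho : vincular m) (pi : 'S_n) : bool :=
  [exists f : {ffun 'I_m -> 'I_n}, is_occurrence rho pi f].

Definition avoiders (m : nat) (rho : vincular m) (n : nat) : {set 'S_n} :=
  [set pi | ~~ contains rho pi].

Definition wilf_equivalent (m m' : nat) (rho : vincular m)
    (rho' : vincular m') : Prop :=
  forall n : nat, #|avoiders rho n| = #|avoiders rho' n|.

Definition avoiders_from (m : nat) (rho : vincular m) (n : nat)
    (a : 'I_n.+1) : {set 'S_n.+1} :=
  [set pi in avoiders rho n.+1 | pi ord0 == a].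

(* s_1 s_2 ... s_k - s_(k+1) *)
Definition last_dash (k : nat) (s : 'S_k.+1) : vincular k.+1 :=
  @Vincular k.+1 s [set g : 'I_k | g == k.-1 :> nat].

(* Permutations compose from left to right in MathComp, so this acts on the    *)
(* letters, not on the positions.                                              *)
Definition swap_letters (m : nat) (rho : vincular m) (u v : 'I_m) :
    vincular m :=
  Vincular (letters rho * tperm u v)%g (dashes rho).

(* Main.v *)
Require Import Defs.
From mathcomp Require Import all_boot all_fingroup.
From mathcomp Require Import zify.

(* Call w "starting" when its first k letters form the unimodal factor.  A
   starting word violates sigma (tau) at position 0 iff some later letter is above
   the peak (strictly between the second largest letter of the factor and the
   peak).  So it is harmless for sigma iff the peak is the largest letter, and for
   tau iff the peak is the successor of the second letter; sliding the peak letter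
   between these two values is a bijection which changes neither the first letter
   nor the relative order of the letters from position k - 1 on.  Two occurrences
   of the factor share at most one letter, so deleting the first letter or the
   first k - 1 letters of a starting word loses the same occurrences, and
   inclusion-exclusion gives a recursion for the number of avoiders with given
   first letter which is the same for sigma and tau. *)

Set Implicit Arguments.
Unset Strict Implicit.
Unset Printing Implicit Defensive.

(** * One-line notations as plain sequences, and counting over them *)

Definition words n := permutations (iota 0 n).

Lemma mem_words n (w : seq nat) :
  (w \in words n) = [&& uniq w, size w == n & all (fun y => y < n) w].
Proof.
rewrite mem_permutations; apply/idP/and3P => [Pw | [Uw /eqP sw /allP lw]].
  rewrite (perm_uniq Pw) iota_uniq (perm_size Pw) size_iota eqxx.
  by split=> //; apply/allP => y; rewrite (perm_mem Pw) mem_iota.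
have sub : {subset w <= iota 0 n} by move=> y /lw; rewrite mem_iota.
have [] := uniq_min_size Uw sub; first by rewrite size_iota sw.
by move=> _ E; apply: uniq_perm => //; apply: iota_uniq.
Qed.

Lemma nth_words_lt n (w : seq nat) p : w \in words n -> p < n -> nth 0 w p < n.
Proof.
rewrite mem_words => /and3P[_ /eqP <- /all_nthP]; apply.
Qed.

Lemma words_index n (w : seq nat) y : w \in words n -> y < n ->
  exists2 q, q < size w & nth 0 w q = y.
Proof.
move=> wn yn; apply/(nthP 0).
by move: wn; rewrite mem_permutations => /perm_mem ->; rewrite mem_iota.
Qed.

Lemma mem_drop_nth k q (w : seq nat) :
  k <= q -> q < size w -> nth 0 w q \in drop k w.
Proof.
move=> kq qw; rewrite -(subnKC kq) -nth_drop mem_nth // size_drop.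
exact: ltn_sub2r (leq_ltn_trans kq qw) qw.
Qed.

Lemma size_words n : size (words n) = n`!.
Proof. by rewrite size_permutations ?iota_uniq // size_iota. Qed.

Lemma bump_inj h : injective (bump h).
Proof. exact: can_inj (@bumpK h). Qed.

(** A word is its first letter [x] followed by a standardized word in which [bump x] makes room for
    [x]. One inclusion suffices, as both lists are duplicate-free of length (n+1)!. *)
Lemma perm_words_cons n :
  perm_eq (words n.+1)
          [seq x :: map (bump x) t | x <- iota 0 n.+1, t <- words n].
Proof.
have U : uniq [seq x :: map (bump x) t | x <- iota 0 n.+1, t <- words n].
  apply: allpairs_uniq; rewrite ?iota_uniq ?permutations_uniq //.
  by move=> [x t] [y u] _ _ /= [-> /(inj_map (@bump_inj y)) ->].
have sub : {subset [seq x :: map (bump x) t | x <- iota 0 n.+1, t <- words n]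
              <= words n.+1}.
  move=> w /allpairsP[[x t] /= [xn tn ->]]; move: xn tn.
  rewrite -[0 :: _]/(iota 0 n.+1) mem_iota !mem_words /= => xn /and3P[Ut /eqP st /allP lt].
  rewrite size_map st eqxx map_inj_uniq ?Ut; last exact: bump_inj.
  rewrite xn andbT /=; apply/andP; split.
    by apply/mapP => -[y _ E]; have := neq_bump x y; rewrite -E eqxx.
  by apply/allP => _ /mapP[y /lt yn ->]; rewrite /bump; lia.
have [|_ E] := uniq_min_size U sub.
  by rewrite size_words size_allpairs size_iota size_words factS.
by rewrite perm_sym; apply: uniq_perm => //; apply: permutations_uniq.
Qed.

Lemma count_words_cons n (Q : pred (seq nat)) :
  count Q (words n.+1) =
  sumn [seq count (fun t => Q (x :: map (bump x) t)) (words n)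
       | x <- iota 0 n.+1].
Proof.
rewrite (seq.permP (perm_words_cons n)) count_flatten -map_comp.
by congr sumn; apply: eq_map => x /=; rewrite count_map.
Qed.

(** [g] undoes [f] where [P] holds, so [f] is injective there. Used in both directions, this equates
    two counts. *)
Lemma count_le_inj (T : eqType) (L : seq T) (P Q : pred T) (f g : T -> T) :
  uniq L ->
  (forall w, w \in L -> P w -> [/\ f w \in L, Q (f w) & g (f w) = w]) ->
  count P L <= count Q L.
Proof.
move=> UL H; rewrite -!size_filter -(size_map f (filter P L)).
apply: uniq_leq_size => [|z /mapP[w]].
  rewrite map_inj_in_uniq ?filter_uniq // => x y.
  rewrite !mem_filter => /andP[Px xL] /andP[Py yL] E.
  by have [_ _ <-] := H x xL Px; have [_ _ <-] := H y yL Py; rewrite E.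
by rewrite !mem_filter => /andP[Pw wL] ->; have [-> -> _] := H w wL Pw.
Qed.

Lemma count_pairs (T : eqType) (L : seq T) (P1 P2 P3 P4 : pred T) :
  (forall w, w \in L -> P1 w + P2 w = P3 w + P4 w :> nat) ->
  count P1 L + count P2 L = count P3 L + count P4 L.
Proof.
elim: L => //= x L IH H.
rewrite addnACA H ?mem_head // IH; first by rewrite addnACA.
by move=> w wL; apply: H; rewrite inE wL orbT.
Qed.

Definition isom m (r v : nat -> nat) : bool :=
  [forall p : 'I_m, forall q : 'I_m, (v p < v q) == (r p < r q)].

Lemma isomP m r v :
  reflect (forall p q, p < m -> q < m -> (v p < v q) = (r p < r q))
          (isom m r v).
Proof.
apply: (iffP forallP) => [H p q pm qm | H p].
  by have /forallP/(_ (Ordinal qm))/eqP := H (Ordinal pm).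
by apply/forallP => q; apply/eqP; apply: H.
Qed.

(** The block is the first [k] letters; the dash lets the last letter [y] be any later one. In a
    word of at most [k] letters there is no such [y]. *)
Definition head_occ k r (w : seq nat) : bool :=
  has (fun y => isom k.+1 r (nth 0 (rcons (take k w) y))) (drop k w).

Fixpoint avoids k r (w : seq nat) : bool :=
  if w is _ :: u then ~~ head_occ k r w && avoids k r u else true.

Definition starts k r (w : seq nat) : bool :=
  (k <= size w) && isom k r (nth 0 w).

Lemma head_occ_nil k r : head_occ k r [::] = false.
Proof. by rewrite /head_occ; case: k. Qed.

Lemma avoids_behead k r (w : seq nat) :
  avoids k r w = ~~ head_occ k r w && avoids k r (behead w).
Proof. by case: w => //; rewrite head_occ_nil. Qed.

Lemma avoidsPn k r (w : seq nat) :
  reflect (exists j, head_occ k r (drop j w)) (~~ avoids k r w).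
Proof.
elim: w => [|x w IH]; first by constructor=> -[j]; rewrite head_occ_nil.
rewrite avoids_behead negb_and negbK; apply: (iffP orP) => [[b | /IH[j b]] | [[|j] b]].
- by exists 0; rewrite drop0.
- by exists j.+1.
- by left; rewrite drop0 in b.
- by right; apply/IH; exists j.
Qed.

Lemma head_occ_map k r f (w : seq nat) :
  {mono f : x y / x < y} -> head_occ k r (map f w) = head_occ k r w.
Proof.
move=> Hf; rewrite /head_occ -map_drop -map_take has_map.
have [wk|kw] := leqP (size w) k; first by rewrite drop_oversize.
apply: eq_has => y /=; rewrite -map_rcons.
have sz : size (rcons (take k w) y) = k.+1 by rewrite size_rcons size_takel // ltnW.
by apply/isomP/isomP => H p q pk qk; have := H p q pk qk;
   rewrite !(nth_map 0) ?sz // Hf.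
Qed.

Lemma avoids_map k r f (w : seq nat) :
  {mono f : x y / x < y} -> avoids k r (map f w) = avoids k r w.
Proof.
move=> Hf; elim: w => // x w IH.
by rewrite map_cons /= -map_cons head_occ_map // IH.
Qed.

Lemma ltn_bump h : {mono bump h : x y / x < y}.
Proof. by move=> x y; rewrite !ltnNge leq_bump2. Qed.

(* R may depend on the prefix up to and including the first letter of the avoiding
   suffix, so that this statement passes from n to n.+1 by prepending a letter. *)
Definition same_count k r r' m n := forall R : pred (seq nat),
  count (fun w => R (take m.+1 w) && avoids k r (drop m w)) (words n) =
  count (fun w => R (take m.+1 w) && avoids k r' (drop m w)) (words n).

(** Classify words by their first letter [x]: it becomes a parameter of the prefix condition, and
    [bump x] on the rest does not affect avoidance. *)
Lemma same_countS k r r' m n :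
  same_count k r r' m n -> same_count k r r' m.+1 n.+1.
Proof.
move=> H R; rewrite !count_words_cons; congr sumn; apply: eq_map => x.
have := H (fun v => R (x :: map (bump x) v)).
congr (_ = _); apply: eq_count => t /=; rewrite -map_take -map_drop avoids_map //;
  exact: ltn_bump.
Qed.

(** Deleting [m] letters leads to the smaller length [n - m], or to the empty word if [n < m]. *)
Lemma same_count_add k r r' m n :
  (forall n', n' < n -> same_count k r r' 0 n') ->
  0 < m -> same_count k r r' m n.
Proof.
elim: m n => // m IH [|n] H _; first by move=> R.
apply: same_countS; case: m IH => [|m] IH; first exact: H.
by apply: IH => // n' n'n; apply: H; apply: ltnW.
Qed.

Lemma starts_take k r m (w : seq nat) :
  k <= m -> starts k r (take m w) = starts k r w.
Proof.
move=> km; rewrite /starts size_take_min leq_min km /=; congr (_ && _).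
by apply/isomP/isomP => H p q pk qk; have := H p q pk qk;
   rewrite !nth_take //; lia.
Qed.

(** * Words starting with the unimodal block *)

Section UnimodalPattern.

(* Position d carries the peak of the first k letters, position e the second
   largest of them; r is the pattern sigma and r' the pattern tau. *)
Variables (k d e : nat) (r r' : nat -> nat).
Hypotheses (d_gt0 : 0 < d) (d_lt : d.+1 < k) (e_lt : e < k) (e_neq : e != d).
Hypothesis r_incr : forall p q, p < q -> q <= d -> r p < r q.
Hypothesis r_decr : forall p q, d <= p -> p < q -> q < k -> r q < r p.
Hypothesis r_second : forall p, p < k -> p != d -> r p <= r e.
Hypothesis r_peak : r e < r d.
Hypothesis r_last : forall p, p < k -> r p < r k.
Hypothesis r'_eq : forall p, p < k -> p != d -> r' p = r p.
Hypothesis r'_last : r e < r' k.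
Hypothesis r'_peak : r' k < r' d.

Let starts := starts k r.

Lemma startsP (w : seq nat) :
  reflect (k <= size w /\ forall p q, p < k -> q < k ->
             (nth 0 w p < nth 0 w q) = (r p < r q))
          (starts w).
Proof.
by apply: (iffP andP) => -[kw /isomP H]; split=> //; apply/isomP.
Qed.

Lemma r_lt_peak p : p < k -> p != d -> r p < r d.
Proof. by move=> pk pd; apply: leq_ltn_trans (r_second pk pd) r_peak. Qed.

Lemma starts_second (w : seq nat) p :
  starts w -> p < k -> p != d -> nth 0 w p <= nth 0 w e.
Proof.
by move=> /startsP[kw H] pk pd; rewrite leqNgt H // -leqNgt r_second.
Qed.

Lemma starts_peak (w : seq nat) : starts w -> nth 0 w e < nth 0 w d.
Proof. by move=> /startsP[kw H]; rewrite H //; lia. Qed.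

Lemma starts_le_peak (w : seq nat) p :
  starts w -> p < k -> nth 0 w p <= nth 0 w d.
Proof.
move=> sw pk; have [->//|pd] := eqVneq p d.
by apply: leq_trans (starts_second sw pk pd) _; apply/ltnW/starts_peak.
Qed.

(** The peak wins every comparison within the block, so its letter may be replaced by anything above
    the second largest one. *)
Lemma starts_change_peak (w w' : seq nat) :
  starts w -> k <= size w' ->
  (forall p, p < k -> p != d -> nth 0 w' p = nth 0 w p) ->
  nth 0 w e < nth 0 w' d -> starts w'.
Proof.
move=> sw kw' E lt; have [kw H] := startsP _ sw; apply/startsP; split=> // p q pk qk.
have [->|pd] := eqVneq p d; have [->|qd] := eqVneq q d.
- by rewrite !ltnn.
- have := starts_second sw qk qd; have := r_lt_peak qk qd; rewrite (E q) //; lia.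
- have := starts_second sw pk pd; have := r_lt_peak pk pd; rewrite (E p) //; lia.
- by rewrite !E // H.
Qed.

(** Nothing forces [y] to differ from the letters of [w], hence comparisons with [y] in both
    directions. *)
Lemma isom_rcons rr (w : seq nat) y :
  k <= size w ->
  isom k.+1 rr (nth 0 (rcons (take k w) y)) <->
  [/\ forall p q, p < k -> q < k -> (nth 0 w p < nth 0 w q) = (rr p < rr q),
      forall p, p < k -> (nth 0 w p < y) = (rr p < rr k) &
      forall p, p < k -> (y < nth 0 w p) = (rr k < rr p)].
Proof.
move=> kw.
have nk p : p < k -> nth 0 (rcons (take k w) y) p = nth 0 w p.
  by move=> pk; rewrite nth_rcons size_takel // pk nth_take.
have nl : nth 0 (rcons (take k w) y) k = y.
  by rewrite nth_rcons size_takel // ltnn eqxx.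
split=> [/isomP H|[H1 H2 H3]].
  split=> [p q pk qk|p pk|p pk].
  - by rewrite -H ?nk //; lia.
  - by rewrite -H ?nl ?nk //; lia.
  - by rewrite -H ?nl ?nk //; lia.
apply/isomP => p q; rewrite !ltnS (leq_eqVlt p) (leq_eqVlt q).
move=> /predU1P[->|pk] /predU1P[->|qk]; rewrite ?nl ?nk ?ltnn //;
  [exact: H3 | exact: H2 | exact: H1].
Qed.

(** The last letter of sigma is its largest and the peak dominates the block, so one comparison with
    the peak decides. *)
Lemma head_occ_r (w : seq nat) :
  head_occ k r w = starts w && has (fun y => nth 0 w d < y) (drop k w).
Proof.
have [wk|kw] := leqP (size w) k; first by rewrite /head_occ drop_oversize //= andbF.
apply/idP/andP => [/hasP[y yw /(isom_rcons _ _ (ltnW kw))[H1 H2 _]]|[sw]].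
  split; first by apply/startsP; split=> //; apply: ltnW.
  by apply/hasP; exists y => //; rewrite H2 ?r_last //; lia.
move=> /hasP[y yw lt]; apply/hasP; exists y => //.
apply/isom_rcons; first exact: ltnW.
have [_ H] := startsP _ sw; split=> // p pk; have := starts_le_peak sw pk;
  have := r_last pk; lia.
Qed.

Lemma head_occ_r' (w : seq nat) : head_occ k r' w =
  starts w && has (fun y => nth 0 w e < y < nth 0 w d) (drop k w).
Proof.
have [wk|kw] := leqP (size w) k; first by rewrite /head_occ drop_oversize //= andbF.
have r'_lt p : p < k -> p != d -> r' p < r' k.
  by move=> pk pd; rewrite r'_eq //; apply: leq_ltn_trans (r_second pk pd) _.
(* The blocks of sigma and tau are order-isomorphic, so [starts], stated with [r], serves both. *)
have r'_iso p q : p < k -> q < k -> (r' p < r' q) = (r p < r q).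
  move=> pk qk; have [->|pd] := eqVneq p d; have [->|qd] := eqVneq q d.
  - by rewrite !ltnn.
  - have := r_lt_peak qk qd; have := r'_lt q qk qd; lia.
  - have := r_lt_peak pk pd; have := r'_lt p pk pd; lia.
  - by rewrite !r'_eq.
apply/idP/andP => [/hasP[y yw /(isom_rcons _ _ (ltnW kw))[H1 H2 H3]]|[sw]].
  split.
    by apply/startsP; split=> [|p q pk qk]; [exact: ltnW | rewrite H1 ?r'_iso].
  apply/hasP; exists y => //; rewrite H2 // H3; last by lia.
  by rewrite r'_lt.
move=> /hasP[y yw /andP[lt1 lt2]]; apply/hasP; exists y => //.
apply/isom_rcons; first exact: ltnW.
have [_ H] := startsP _ sw.
split=> [p q pk qk|p pk|p pk]; first by rewrite r'_iso ?H.
- have [->|pd] := eqVneq p d; first by lia.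
  have := starts_second sw pk pd; have := r'_lt p pk pd; lia.
- have [->|pd] := eqVneq p d; first by lia.
  have := starts_second sw pk pd; have := r'_lt p pk pd; lia.
Qed.

(** For [j < d] the descent after the peak would have to be an ascent of the shifted block; for
    [j >= d] the initial ascent of the shifted block falls on a descent of the first. The shift by
    [k.-1], which shares one letter, is not excluded. *)
Lemma starts_overlap (w : seq nat) j :
  starts w -> 0 < j < k.-1 -> ~~ starts (drop j w).
Proof.
move=> /startsP[kw H] /andP[j0 jk]; apply/negP => /startsP[_ H'].
have [jd|dj] := ltnP j d.
  have := H' (d - j) (d - j).+1; rewrite !nth_drop.
  have -> : j + (d - j) = d by lia.
  have -> : j + (d - j).+1 = d.+1 by lia.
  rewrite H; [|lia..].
  have := @r_decr d d.+1; have := @r_incr (d - j) (d - j).+1; lia.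
have := H' 0 1; rewrite !nth_drop addn0 addn1 H; [|lia..].
have := @r_decr j j.+1; have := @r_incr 0 1; lia.
Qed.

(** An occurrence lost between [behead w] and [drop k.-1 w] would begin at one of the positions 1 to
    k-2, where no block can start. *)
Lemma avoids_starts rr (w : seq nat) :
  (forall v, head_occ k rr v -> starts v) ->
  starts w -> avoids k rr (behead w) = avoids k rr (drop k.-1 w).
Proof.
move=> bs sw; rewrite -drop1.
suff H j : j < k.-1 -> avoids k rr (drop 1 w) = avoids k rr (drop j.+1 w).
  by have := H k.-2; rewrite prednK; [apply|]; lia.
elim: j => // j IH jk; rewrite IH; last by lia.
rewrite avoids_behead -drop1 drop_drop add1n; case: (boolP (head_occ _ _ _)) => // /bs.
by rewrite (negbTE (starts_overlap sw _)) //; lia.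
Qed.

(** * Harmless peaks and the slide between them *)

(** The letter [n.-1] occurs somewhere: inside the block it must be the peak, after the block it
    completes an occurrence. *)
Lemma no_head_occ_r n (w : seq nat) : w \in words n -> starts w ->
  ~~ head_occ k r w = (nth 0 w d == n.-1).
Proof.
move=> wn sw; have [kw _] := startsP _ sw; rewrite head_occ_r sw /=.
have := wn; rewrite mem_words => /and3P[Uw /eqP szw /allP lw].
have lt := nth_words_lt wn; apply/idP/eqP => [/hasPn H|E].
  have n1 : n.-1 < n by lia.
  have [q qw Eq] := words_index wn n1; have [qk|kq] := ltnP q k.
    have := starts_le_peak sw qk; have := lt d; lia.
  by have := H _ (mem_drop_nth kq qw); have := lt d; lia.
apply/hasPn => y /mem_drop /lw; lia.
Qed.

(** If the peak exceeds the successor of the second largest letter, that successor is not in the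
    block, so it comes later and completes an occurrence. *)
Lemma no_head_occ_r' n (w : seq nat) : w \in words n -> starts w ->
  ~~ head_occ k r' w = (nth 0 w d == (nth 0 w e).+1).
Proof.
move=> wn sw; have [kw _] := startsP _ sw; rewrite head_occ_r' sw /=.
have := wn; rewrite mem_words => /and3P[Uw /eqP szw /allP lw].
have lt := nth_words_lt wn; have pk := starts_peak sw.
apply/idP/eqP => [/hasPn H|E]; last by apply/hasPn => y _; lia.
have en : (nth 0 w e).+1 < n by have := lt d; lia.
have [q qw Eq] := words_index wn en; have [qk|kq] := ltnP q k.
  have [<-//|qd] := eqVneq q d.
  by have := starts_second sw qk qd; lia.
by have := H _ (mem_drop_nth kq qw); lia.
Qed.

(* These slide the peak letter from n.-1 down to x and back, keeping the relative
   order of the other letters. *)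
Definition lower n x y := if y == n.-1 then x else bump x y.
Definition raise n x y := if y == x then n.-1 else unbump x y.

Lemma lowerK n x y : x < n -> y < n -> raise n x (lower n x y) = y.
Proof.
rewrite /raise /lower => xn yn; have [->|yn1] := eqVneq y n.-1; first by rewrite eqxx.
by rewrite eq_sym (negbTE (neq_bump _ _)) bumpK.
Qed.

Lemma raiseK n x y : x < n -> y < n -> lower n x (raise n x y) = y.
Proof.
rewrite /raise /lower => xn yn; have [->|yx] := eqVneq y x; first by rewrite eqxx.
by rewrite /bump /unbump; case: eqP; lia.
Qed.

Lemma map_words n f g (w : seq nat) :
  (forall y, y < n -> f y < n /\ g (f y) = y) ->
  w \in words n -> map f w \in words n.
Proof.
move=> H; rewrite !mem_words size_map => /and3P[Uw -> /allP lw] /=.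
rewrite map_inj_in_uniq ?Uw /=.
  by apply/allP => _ /mapP[y /lw /H[fy _] ->].
by move=> x y /lw/H[_ Ex] /lw/H[_ Ey] E; rewrite -Ex E Ey.
Qed.

Lemma lower_words n x (w : seq nat) :
  x < n -> w \in words n -> map (lower n x) w \in words n.
Proof.
move=> xn; apply: (@map_words n _ (raise n x)) => y yn; split; last exact: lowerK.
by rewrite /lower /bump; case: eqP; lia.
Qed.

Lemma raise_words n x (w : seq nat) :
  x < n -> w \in words n -> map (raise n x) w \in words n.
Proof.
move=> xn; apply: (@map_words n _ (lower n x)) => y yn; split; last exact: raiseK.
by rewrite /raise /unbump; case: eqP; lia.
Qed.

(** The tail begins at the last letter of the block, past the peak as [d.+1 < k]. Away from the peak
    letter the slide is strictly increasing, so it preserves avoidance on the tail. *)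
Lemma peak_notin_tail (w : seq nat) :
  uniq w -> starts w -> nth 0 w d \notin drop k.-1 w.
Proof.
move=> Uw /startsP[kw _]; apply/negP => /(nthP 0)[q]; rewrite size_drop => qw.
rewrite nth_drop => /eqP; rewrite nth_uniq //; lia.
Qed.

Lemma count_good n (a : pred (seq nat)) :
  count (fun w => [&& a (take 1 w), starts w & nth 0 w d == n.-1]
                  && avoids k r' (drop k.-1 w)) (words n) =
  count (fun w => [&& a (take 1 w), starts w & nth 0 w d == (nth 0 w e).+1]
                  && avoids k r' (drop k.-1 w)) (words n).
Proof.
apply/eqP; rewrite eqn_leq; apply/andP; split.
- apply: (@count_le_inj _ _ _ _ (fun w => map (lower n (nth 0 w e).+1) w)
            (fun w => map (raise n (nth 0 w d)) w)); first exact: permutations_uniq.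
  move=> w wn /andP[/and3P[aw sw /eqP dn] avw].
  have [kw _] := startsP _ sw; have pk := starts_peak sw.
  have := wn; rewrite mem_words => /and3P[Uw /eqP szw /allP lw].
  set x := (nth 0 w e).+1; have xn : x < n by have := nth_words_lt wn (p := d); lia.
  have Ed : nth 0 (map (lower n x) w) d = x.
    by rewrite (nth_map 0) ?dn /lower ?eqxx //; lia.
  (* Block letters other than the peak lie below [x], hence the slide fixes them. *)
  have Ep p : p < k -> p != d -> nth 0 (map (lower n x) w) p = nth 0 w p.
    move=> pk' pd; have := starts_second sw pk' pd.
    by rewrite (nth_map 0) /lower /bump; [case: eqP|]; lia.
  split; first exact: lower_words.
    apply/andP; split; [apply/and3P; split|].
    + move: aw; rewrite -map_take; congr (is_true (a _)).
      have := Ep 0; case: (w) kw => [|y u] //= _ ->; [by rewrite take0|lia..].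
    + by apply: (starts_change_peak sw); rewrite ?size_map // Ed.
    + by rewrite Ed Ep.
    + have -> : drop k.-1 (map (lower n x) w) = map (bump x) (drop k.-1 w).
        rewrite -map_drop; apply/eq_in_map => y yw; rewrite /lower -dn.
        case: eqP => // E; case/negP: (peak_notin_tail Uw sw); by rewrite -E.
      by rewrite avoids_map //; apply: ltn_bump.
  rewrite Ed -map_comp -[RHS]map_id; apply/eq_in_map => y /lw yn.
  exact: lowerK.
- apply: (@count_le_inj _ _ _ _ (fun w => map (raise n (nth 0 w d)) w)
            (fun w => map (lower n (nth 0 w e).+1) w)); first exact: permutations_uniq.
  move=> w wn /andP[/and3P[aw sw /eqP de] avw].
  have [kw _] := startsP _ sw; have pk := starts_peak sw.
  have := wn; rewrite mem_words => /and3P[Uw /eqP szw /allP lw].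
  set x := nth 0 w d; have xn : x < n by apply: nth_words_lt => //; lia.
  have Ed : nth 0 (map (raise n x) w) d = n.-1.
    by rewrite (nth_map 0) /raise ?eqxx //; lia.
  have Ep p : p < k -> p != d -> nth 0 (map (raise n x) w) p = nth 0 w p.
    move=> pk' pd; have := starts_second sw pk' pd.
    by rewrite (nth_map 0) /raise /unbump -/x; [case: eqP|]; lia.
  split; first exact: raise_words.
    apply/andP; split; [apply/and3P; split|].
    + move: aw; rewrite -map_take; congr (is_true (a _)).
      have := Ep 0; case: (w) kw => [|y u] //= _ ->; [by rewrite take0|lia..].
    + by apply: (starts_change_peak sw); rewrite ?size_map // Ed; lia.
    + by rewrite Ed.
    (* [unbump x] is not strictly increasing at [x], so the old tail is written as a [bump] of the
       new one. *)
    + have E : drop k.-1 w = map (bump x) (drop k.-1 (map (raise n x) w)).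
        rewrite -map_drop -map_comp -[LHS]map_id; apply/eq_in_map => y yw /=.
        rewrite /raise; case: eqP => [E|/eqP E]; last by rewrite unbumpK.
        by case/negP: (peak_notin_tail Uw sw); rewrite -/x -E.
      by move: avw; rewrite E avoids_map //; apply: ltn_bump.
  rewrite Ep // -de -map_comp -[RHS]map_id; apply/eq_in_map => y /lw yn.
  exact: raiseK.
Qed.

(** * The recursion, and strong induction on the length *)

Lemma head_occ_starts_r (w : seq nat) : head_occ k r w -> starts w.
Proof. by rewrite head_occ_r => /andP[]. Qed.

Lemma head_occ_starts_r' (w : seq nat) : head_occ k r' w -> starts w.
Proof. by rewrite head_occ_r' => /andP[]. Qed.

(* The avoiders are the words whose tail avoids the pattern, except those which
   start with an occurrence; these are in turn the words starting with the
   unimodal factor and with avoiding tail, except those with a harmless peak. *)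
Lemma count_avoiders rr n (a : pred (seq nat)) (good : pred (seq nat)) :
  (forall w, head_occ k rr w -> starts w) ->
  (forall w, w \in words n -> starts w -> ~~ head_occ k rr w = good w) ->
  count (fun w => a (take 1 w) && avoids k rr w) (words n)
  + count (fun w => (a (take 1 w) && starts w) && avoids k rr (drop k.-1 w))
          (words n)
  = count (fun w => a (take 1 w) && avoids k rr (drop 1 w)) (words n)
  + count (fun w => [&& a (take 1 w), starts w & good w]
                    && avoids k rr (drop k.-1 w)) (words n).
Proof.
move=> bs bg.
apply: count_pairs => w wn; rewrite avoids_behead drop1.
have [sw|sw] := boolP (starts w); last by rewrite (contraNF (bs w) sw) /= !andbF.
rewrite bg // (avoids_starts bs) //=.
by case: (a _); case: (good w); case: (avoids _ _ _).
Qed.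

Lemma same_count_unimodal n : same_count k r r' 0 n.
Proof.
elim/ltn_ind: n => n IH a.
have IHm m (Q : pred (seq nat)) : 0 < m -> (forall w, Q (take m.+1 w) = Q w) ->
    count (fun w => Q w && avoids k r (drop m w)) (words n) =
    count (fun w => Q w && avoids k r' (drop m w)) (words n).
  move=> m0 HQ; have := same_count_add IH m0 Q.
  by congr (_ = _); apply: eq_count => w; rewrite HQ.
have k1 : 0 < k.-1 by lia.
have k2 : k.-1.+1 = k by lia.
have s0 w : starts (take k w) = starts w by rewrite /starts starts_take.
have t0 m (w : seq nat) : 0 < m -> take 1 (take m w) = take 1 w.
  by move=> m0; rewrite take_takel.
have E1 := IHm 1 (fun w => a (take 1 w)) isT (fun w => f_equal a (t0 2 w isT)).
(* With [m] equal to [k.-1] the condition may read [m.+1 = k] letters: exactly the block, peak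
   included. *)
have ES := IHm k.-1 (fun w => a (take 1 w) && starts w) k1.
have EG := IHm k.-1 (fun w => [&& a (take 1 w), starts w & nth 0 w d == n.-1]) k1.
have H := count_avoiders a head_occ_starts_r (@no_head_occ_r n).
have H' := count_avoiders a head_occ_starts_r' (@no_head_occ_r' n).
(* Three of the four counts for sigma become those for tau: two by induction, the harmless one by
   induction and the slide. Cancelling leaves the claim. *)
rewrite E1 ES ?EG ?count_good -?H' in H.
- by have := addIn H; congr (_ = _); apply: eq_count => w; rewrite drop0.
- by move=> w; rewrite k2 s0 t0 ?nth_take; lia.
- by move=> w; rewrite k2 s0 t0 //; lia.
Qed.

End UnimodalPattern.

(** * From permutations and occurrences to words *)

Definition word n (pi : 'S_n) : seq nat := [seq val (pi j) | j <- enum 'I_n].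

Lemma size_word n (pi : 'S_n) : size (word pi) = n.
Proof. by rewrite size_map size_enum_ord. Qed.

Lemma nth_word n (pi : 'S_n) (j : 'I_n) : nth 0 (word pi) j = pi j.
Proof. by rewrite (nth_map j) ?size_enum_ord // nth_ord_enum. Qed.

Lemma word_inj n : injective (@word n).
Proof.
move=> pi1 pi2 E; apply/permP => j; apply: val_inj.
by rewrite /= -!nth_word E.
Qed.

Lemma perm_word n : perm_eq [seq word pi | pi <- enum 'S_n] (words n).
Proof.
have U : uniq [seq word pi | pi <- enum 'S_n].
  by rewrite map_inj_uniq ?enum_uniq //; apply: word_inj.
have sub : {subset [seq word pi | pi <- enum 'S_n] <= words n}.
  move=> _ /mapP[pi _ ->]; rewrite mem_words size_word eqxx.
  rewrite map_inj_uniq ?enum_uniq /=; last exact: (inj_comp val_inj (@perm_inj _ pi)).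
  by apply/allP => _ /mapP[j _ ->]; apply: ltn_ord.
have [|_ E] := uniq_min_size U sub; last first.
  by apply: uniq_perm => //; apply: permutations_uniq.
by rewrite size_words size_map -cardT -card_Sn cardT.
Qed.

Lemma card_words n (P : pred (seq nat)) :
  #|[set pi : 'S_n | P (word pi)]| = count P (words n).
Proof.
rewrite -(seq.permP (perm_word n)) count_map -sum1_card -sum1_count.
by rewrite big_enum_cond; apply: eq_bigl => pi; rewrite !inE.
Qed.

Section Transfer.

Variables (k : nat) (rho : vincular k.+1).
Hypothesis k_gt0 : 0 < k.
Hypothesis dashesE : dashes rho = [set g : 'I_k | g == k.-1 :> nat].
Let r p : nat := letters rho (inord p).

(** With the only dash before the last letter, an occurrence amounts to a start [j], the positions
    [j] to [j + k - 1], and one later position. *)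
Lemma containsE n (pi : 'S_n) : contains rho pi = ~~ avoids k r (word pi).
Proof.
apply/idP/idP => [/existsP[f /and3P[/forallP inc /forallP iso /forallP adj]]|].
  apply/avoidsPn; exists (f ord0).
  have f_inc (p q : 'I_k.+1) : p < q -> f p < f q.
    by move=> pq; have /forallP/(_ q)/implyP := inc p; apply.
  have f_adj p : p < k -> f (inord p) = f ord0 + p :> nat.
    elim: p => [|p IH] pk.
      by rewrite addn0; congr (nat_of_ord (f _)); apply/val_inj; rewrite /= inordK.
    have pk' : p < k by lia.
    have := adj (Ordinal pk'); rewrite dashesE inE /=.
    case: eqP => [|_ /=]; first by lia.
    move=> /forallP/(_ (inord p))/forallP/(_ (inord p.+1)).
    rewrite !inordK; try lia.
    by rewrite !eqxx /= => /eqP ->; rewrite IH // addnS.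
  have lt : f ord0 + k.-1 < f ord_max.
    rewrite -f_adj; last by lia.
    by apply: f_inc; rewrite inordK /=; lia.
  have sz := ltn_ord (f ord_max); have szw := size_word pi.
  have kd : k <= size (drop (f ord0) (word pi)) by rewrite size_drop szw; lia.
  have nk p : p < k.+1 -> nth 0 (rcons (take k (drop (f ord0) (word pi)))
      (pi (f ord_max))) p = pi (f (inord p)).
    rewrite ltnS leq_eqVlt nth_rcons size_takel // => /predU1P[->|pk].
      rewrite ltnn eqxx; congr (nat_of_ord (pi (f _))).
      by apply/val_inj; rewrite /= inordK.
    by rewrite pk nth_take // nth_drop -f_adj // nth_word.
  apply/hasP; exists (pi (f ord_max) : nat).
    by rewrite -nth_word drop_drop mem_drop_nth ?szw //; lia.
  apply/isomP => p q pk qk; rewrite !nk // /r.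
  by have /forallP/(_ (inord q))/eqP := iso (inord p).
move=> /avoidsPn[j /hasP[y /(nthP 0)[l]]].
rewrite drop_drop size_drop size_word nth_drop => ln <-.
case: n pi ln => [|n] pi ln; first by lia.
have kd : k <= size (drop j (word pi)) by rewrite size_drop size_word; lia.
move=> /isomP iso.
(* [l] indexes the suffix after the block, so the last letter sits at position [k + j + l]. *)
pose f := [ffun p : 'I_k.+1 =>
  inord (if p < k then j + p else k + j + l) : 'I_n.+1].
have fE (p : 'I_k.+1) : f p = (if p < k then j + p else k + j + l) :> nat.
  by rewrite ffunE inordK //; case: ifP; lia.
have nf (p : 'I_k.+1) : nth 0 (rcons (take k (drop j (word pi)))
    (nth 0 (word pi) (k + j + l))) p = pi (f p).
  rewrite -nth_word fE nth_rcons size_takel //.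
  have [pk|kp] := ltnP p k; first by rewrite nth_take // nth_drop.
  by rewrite ifT //; have := ltn_ord p; lia.
apply/existsP; exists f; apply/and3P; split.
- apply/forallP => p; apply/forallP => q; apply/implyP => pq; rewrite !fE.
  by have := ltn_ord q; case: ifP; case: ifP; lia.
- apply/forallP => p; apply/forallP => q; apply/eqP.
  by rewrite -!nf iso ?ltn_ord // /r !inord_val.
- apply/forallP => g; rewrite dashesE inE; apply/implyP => gk.
  apply/forallP => p; apply/forallP => q; apply/implyP => /andP[/eqP pg /eqP qg].
  apply/eqP; rewrite !fE pg qg; move: (nat_of_ord g) gk (ltn_ord g) => m /= mk mk'.
  by case: ifP; case: ifP; lia.
Qed.

Lemma card_avoiders n : #|avoiders rho n| = count (avoids k r) (words n).
Proof.
rewrite -card_words; apply: eq_card => pi.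
by rewrite !inE containsE negbK.
Qed.

Lemma card_avoiders_from n (a : 'I_n.+1) :
  #|avoiders_from rho a|
  = count (fun w => (take 1 w == [:: val a]) && avoids k r w) (words n.+1).
Proof.
rewrite -card_words; apply: eq_card => pi.
rewrite !inE containsE negbK andbC; congr (_ && _).
rewrite -val_eqE /= -nth_word /=; have := size_word pi.
by case: (word pi) => //= y u _; rewrite take0 eqseq_cons andbT.
Qed.

End Transfer.

(** * Locating the peak and the second largest letter in sigma and tau *)

Theorem theorem3p1 (k i : nat) (s : 'S_k.+1)
  (hk : 3 <= k) (hi : 2 <= i <= k - 1)
  (s_incr : forall p q : 'I_k.+1, p < q -> q <= i - 1 -> s p < s q)
  (s_decr : forall p q : 'I_k.+1, i - 1 <= p -> p < q -> q <= k - 1 -> s q < s p)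
  (s_last : s ord_max = ord_max) :
  let sigma := last_dash s in
  let tau := swap_letters sigma (inord (k - 1)) ord_max in
  wilf_equivalent sigma tau /\
  (forall (n : nat) (a : 'I_n.+1),
     #|avoiders_from sigma a| = #|avoiders_from tau a|).
Proof.
move=> sigma tau.
have k0 : 0 < k by lia.
pose r p : nat := letters sigma (inord p).
pose r' p : nat := letters tau (inord p).
pose d := i - 1.
(* Counted from 0, the last letter of sigma is [k], the peak [k - 1], and the second largest block
   letter [k - 2]. *)
pose eo := (s^-1)%g (inord (k - 2)); pose e : nat := eo.
have val_s p : p < k.+1 -> (inord p : 'I_k.+1) = p :> nat by exact: inordK.
have r_inj p q : p < k.+1 -> q < k.+1 -> r p = r q -> p = q.
  move=> pk qk /val_inj /perm_inj E.
  by rewrite -(val_s p) // E val_s.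
have r_le p : r p <= k by rewrite -ltnS ltn_ord.
have r_k : r k = k.
  rewrite /r (_ : inord k = ord_max) ?s_last //=; last first.
    by apply: val_inj; rewrite /= inordK.
have r_e : r e = k - 2.
  by rewrite /r /e inord_val /= /eo permKV inordK //; lia.
have incr p q : p < q -> q <= d -> r p < r q.
  by move=> pq qd; apply: s_incr; rewrite ?inordK //; lia.
have decr p q : d <= p -> p < q -> q < k -> r q < r p.
  by move=> dp pq qk; apply: s_decr; rewrite ?inordK //; lia.
have lt_k p : p < k -> r p < k.
  move=> pk; have := r_le p; rewrite leq_eqVlt => /predU1P[E|//].
  by have := r_inj p k; rewrite r_k E; lia.
have lt_d p : p < k -> p != d -> r p < r d.
  move=> pk pd; have [pd'|dp] := ltnP p d; first exact: incr.
  by apply: decr; lia.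
have r_d : r d = k - 1.
  (* The letter [k - 1] is not at the end; at a block position other than [d] it would be smaller
     than [r d], which is itself below [k]. *)
  pose q := (s^-1)%g (inord (k - 1)).
  have r_q : r q = k - 1 by rewrite /r inord_val /= permKV inordK //; lia.
  have qk := ltn_ord q.
  have q_neq : q != k :> nat by apply/eqP => E; move: r_q; rewrite E r_k; lia.
  have [<-//|qd] := eqVneq (nat_of_ord q) d.
  have := lt_d q; have := lt_k d; have := lt_k q; lia.
have e_k : e < k.
  have : e < k.+1 by apply: ltn_ord.
  rewrite ltnS leq_eqVlt => /predU1P[E|//]; move: r_e; rewrite E r_k; lia.
have e_d : e != d by apply/eqP => E; move: r_e; rewrite E r_d; lia.
have second p : p < k -> p != d -> r p <= r e.
  by move=> pk pd; have := lt_d p pk pd; lia.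
have r'E p : r' p = tperm (inord (k - 1)) ord_max (s (inord p)).
  by rewrite /r' /= permM.
have r'_k : r' k = k - 1.
  rewrite r'E (_ : s (inord k) = ord_max) ?tpermR ?inordK //; first by lia.
  by apply: val_inj; apply: r_k.
have r'_d : r' d = k.
  rewrite r'E (_ : s (inord d) = inord (k - 1)) ?tpermL //.
  by apply: val_inj; rewrite /= inordK -?r_d //; lia.
have r'_eq p : p < k -> p != d -> r' p = r p.
  move=> pk pd; rewrite r'E tpermD //.
    apply/eqP => /(congr1 val); rewrite /= inordK; last by lia.
    by have := lt_d p pk pd; rewrite r_d /r /= => lt E; rewrite E ltnn in lt.
  apply/eqP => /(congr1 val) /= E.
  by have := lt_k p pk; rewrite /r /= -E ltnn.
have count_eq n : same_count k r r' 0 n.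
  apply: (@same_count_unimodal k d e) => //; try lia.
  by move=> p; rewrite r_k; apply: lt_k.
split=> [n|n a].
  (* The trivial prefix condition counts all avoiders; prescribing the one-letter prefix refines the
     count by first letter. *)
  rewrite !card_avoiders //; have := count_eq n predT.
  by congr (_ = _); apply: eq_count => w; rewrite drop0.
rewrite !card_avoiders_from //; have := count_eq n.+1 (fun w => w == [:: val a]).
by congr (_ = _); apply: eq_count => w; rewrite drop0.
Qed.
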